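(* Let $Q_1\subset\mathbb{R}^{n_1}$ and $Q_2\subset\mathbb{R}^{n_2}$ be nonempty closed convex sets, let $\|\cdot\|$ denote a norm on each of $\mathbb{R}^{n_1},\mathbb{R}^{n_2}$, and let $f:\mathbb{R}^{n_1}\times\mathbb{R}^{n_2}\to\mathbb{R}$ be a differentiable convex function for which there are $L_1,L_2>0$ with $$f(u,v)\le f(\xi,\eta)+\langle\nabla_1 f(\xi,\eta),u-\xi\rangle+\langle\nabla_2 f(\xi,\eta),v-\eta\rangle+\frac{L_1}{2}\|u-\xi\|^2+\frac{L_2}{2}\|v-\eta\|^2$$ for all $u,\xi\in Q_1$ and $v,\eta\in Q_2$. Let $g_1:\mathbb{R}^{n_1}\to\mathbb{R}$ and $g_2:\mathbb{R}^{n_2}\to\mathbb{R}$ be convex, put $F(x_1,x_2)=f(x_1,x_2)+g_1(x_1)+g_2(x_2)$, and assume $F$ attains its minimum $F^*$ over $Q_1\times Q_2$. Let $x^k=(x_1^k,x_2^k)$ and $x^{k+\frac12}=(x_1^{k+1},x_2^k)$ be the points generated by the alternating minimization algorithm started at some $x^0\in Q_1\times Q_2$. Let $0<\mu_1\le L_1$ and $0<\mu_2\le L_2$, and suppose that $F$ satisfies the proximal Polyak-Łojasiewicz inequalities $$F^*\ge F(x^k)-\frac{1}{2\mu_1}\mathcal{D}_1(x^k,\mu_1),\qquad F^*\ge F(x^{k+\frac12})-\frac{1}{2\mu_2}\mathcal{D}_2(x^{k+\frac12},\mu_2)\qquad\text{for all }k\ge0.$$ Then for all $k\ge0$ $$F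(x^{k+1})-F^*\le\Big(1-\frac{\mu_2}{L_2}\Big)\Big(1-\frac{\mu_1}{L_1}\Big)\big[F(x^k)-F^*\big].$$
   Context: Alternating minimization algorithm: given $x^0=(x_1^0,x_2^0)\in Q_1\times Q_2$, for $k=0,1,2,\dots$ choose $x_1^{k+1}\in\operatorname{argmin}_{z\in Q_1}\{f(z,x_2^k)+g_1(z)\}$ and then $x_2^{k+1}\in\operatorname{argmin}_{z\in Q_2}\{f(x_1^{k+1},z)+g_2(z)\}$; all these minimizers are assumed to exist. Notation: $\nabla_i f$ is the partial gradient of $f$ with respect to block $i$. For $x=(x_1,x_2)\in Q_1\times Q_2$, $M>0$ and $i\in\{1,2\}$, $$\mathcal{D}_i(x,M)=-2M\min_{u\in Q_i}\Big[\langle\nabla_i f(x),u-x_i\rangle+\frac M2\|u-x_i\|^2+g_i(u)-g_i(x_i)\Big].$$ *)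

(* Defs.v *)
From HB Require Import structures.
From mathcomp Require Import all_boot all_order all_algebra.
From mathcomp Require Import all_classical all_reals all_analysis.

Set Implicit Arguments.
Unset Strict Implicit.
Unset Printing Implicit Defensive.

Import Order.TTheory GRing.Theory Num.Theory.
Import numFieldNormedType.Exports.

Local Open Scope classical_set_scope.
Local Open Scope ring_scope.

(* An arbitrary norm on R^n, unrelated to the sup norm carried by 'rV[R]_n in
   the library; all norms on R^n are equivalent, so closedness and
   differentiability do not depend on this choice. *)
Record is_norm (R : realType) (n : nat) (N : 'rV[R]_n -> R) : Prop := IsNorm {
  is_norm_eq0 : forall u, N u = 0 -> u = 0 ;
  is_normZ : forall a u, N (a *: u) = `|a| * N u ;
  is_normD : forall u v, N (u + v) <= N u + N v }.

Definition dotr (R : realType) (n : nat) (u v : 'rV[R]_n) : R :=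
  \sum_(i < n) u 0 i * v 0 i.

Definition argmin (R : realType) (T : Type) (Q : set T) (phi : T -> R) :
    set T :=
  [set z | Q z /\ forall u, Q u -> phi z <= phi u].

Section TwoBlocks.
Context {R : realType} {n1 n2 : nat}.
Implicit Types (f : 'rV[R]_n1 * 'rV[R]_n2 -> R) (x : 'rV[R]_n1 * 'rV[R]_n2).

Definition grad1 f x : 'rV[R]_n1 :=
  \row_(j < n1) 'D_(delta_mx 0 j) (fun u => f (u, x.2) : R^o) x.1.

Definition grad2 f x : 'rV[R]_n2 :=
  \row_(j < n2) 'D_(delta_mx 0 j) (fun v => f (x.1, v) : R^o) x.2.

Definition composite f (g1 : 'rV[R]_n1 -> R) (g2 : 'rV[R]_n2 -> R) x : R :=
  f x + g1 x.1 + g2 x.2.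

Definition alternating_minimization
    (Q1 : set 'rV[R]_n1) (Q2 : set 'rV[R]_n2) f
    (g1 : 'rV[R]_n1 -> R) (g2 : 'rV[R]_n2 -> R)
    (x : nat -> 'rV[R]_n1 * 'rV[R]_n2) : Prop :=
  (Q1 `*` Q2) (x 0%N) /\
  forall k,
    argmin Q1 (fun z => f (z, (x k).2) + g1 z) (x k.+1).1 /\
    argmin Q2 (fun z => f ((x k.+1).1, z) + g2 z) (x k.+1).2.

(* The point x^{k+1/2} = (x_1^{k+1}, x_2^k). *)
Definition half_step (x : nat -> 'rV[R]_n1 * 'rV[R]_n2) (k : nat) :
    'rV[R]_n1 * 'rV[R]_n2 :=
  ((x k.+1).1, (x k).2).

End TwoBlocks.

Definition prox_model (R : realType) (n : nat) (N : 'rV[R]_n -> R)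
    (g : 'rV[R]_n -> R) (d xi : 'rV[R]_n) (M : R) (u : 'rV[R]_n) : R :=
  dotr d (u - xi) + M / 2 * N (u - xi) ^+ 2 + g u - g xi.

(* The minimum is rendered by the infimum of the set of values.  For M > 0,
   g convex and Q nonempty and closed, the model is continuous and coercive, so
   the infimum is attained; it is then the minimum, see prox_gapE. *)
Definition prox_gap (R : realType) (n : nat) (Q : set 'rV[R]_n)
    (N : 'rV[R]_n -> R) (g : 'rV[R]_n -> R) (d xi : 'rV[R]_n) (M : R) : R :=
  - 2 * M * inf [set prox_model N g d xi M u | u in Q].

Lemma prox_gapE (R : realType) (n : nat) (Q : set 'rV[R]_n)
    (N : 'rV[R]_n -> R) (g : 'rV[R]_n -> R) (d xi : 'rV[R]_n) (M : R)
    (u : 'rV[R]_n) :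
  argmin Q (prox_model N g d xi M) u ->
  prox_gap Q N g d xi M = - 2 * M * prox_model N g d xi M u.
Proof.
move=> [Qu umin]; rewrite /prox_gap; congr (_ * _).
apply/eqP; rewrite eq_le; apply/andP; split.
- apply: ge_inf; last by exists u.
  by exists (prox_model N g d xi M u) => _ [v Qv <-]; exact: umin.
- apply: lb_le_inf; first by exists (prox_model N g d xi M u), u.
  by move=> _ [v Qv <-]; exact: umin.
Qed.

Section BlockGaps.
Context {R : realType} {n1 n2 : nat}.
Implicit Types (f : 'rV[R]_n1 * 'rV[R]_n2 -> R) (x : 'rV[R]_n1 * 'rV[R]_n2).

Definition D1 (Q1 : set 'rV[R]_n1) (N1 : 'rV[R]_n1 -> R) f
    (g1 : 'rV[R]_n1 -> R) x (M : R) : R :=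
  prox_gap Q1 N1 g1 (grad1 f x) x.1 M.

Definition D2 (Q2 : set 'rV[R]_n2) (N2 : 'rV[R]_n2 -> R) f
    (g2 : 'rV[R]_n2 -> R) x (M : R) : R :=
  prox_gap Q2 N2 g2 (grad2 f x) x.2 M.

End BlockGaps.

(* Main.v *)
(* One exact block step contracts F - F^* by 1 - mu/L.  By smoothness the step
   changes F by at most the value of the model with constant L at any u in Q.
   Taking u = xi + (mu/L)(v - xi), convexity of g bounds that value by mu/L
   times the value at v of the model with constant mu, whose infimum over v is
   at most F^* - F by the proximal Polyak-Lojasiewicz inequality. *)

Require Import Defs.
From HB Require Import structures.
From mathcomp Require Import all_boot all_order all_algebra.
From mathcomp Require Import all_classical all_reals all_analysis.
From mathcomp Require Import ring lra.

Set Implicit Arguments.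
Unset Strict Implicit.
Unset Printing Implicit Defensive.

Import Order.TTheory GRing.Theory Num.Theory.
Import numFieldNormedType.Exports.

Local Open Scope classical_set_scope.
Local Open Scope ring_scope.

Lemma is_norm0 (R : realType) (n : nat) (N : 'rV[R]_n -> R) :
  is_norm N -> N 0 = 0.
Proof. by move=> hN; rewrite -(scale0r 0) (is_normZ hN) normr0 mul0r. Qed.

Lemma dotrZr (R : realType) (n : nat) (a : R) (u v : 'rV[R]_n) :
  dotr u (a *: v) = a * dotr u v.
Proof.
by rewrite /dotr mulr_sumr; apply: eq_bigr => i _; rewrite mxE mulrCA.
Qed.

Lemma dotr0 (R : realType) (n : nat) (u : 'rV[R]_n) : dotr u 0 = 0.
Proof. by rewrite -(scale0r 0) dotrZr mul0r. Qed.

Section BlockStep.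
Context {R : realType} {n : nat}.
Variables (Q : set 'rV[R]_n) (N : 'rV[R]_n -> R) (g : 'rV[R]_n -> R).
Hypothesis Q_convex : convex_set (Q : set (convex_lmodType 'rV[R]_n)).
Hypothesis N_norm : is_norm N.
Hypothesis g_convex : @convex_function R 'rV[R]_n setT g.

(** The fraction [t = mu / L] is chosen for the quadratic term: moving only [t] of the way from [xi]
    to [v] multiplies it by [t ^+ 2], and [L * t ^+ 2 = t * mu], so it scales by exactly [t] once
    [L] is traded for [mu], just as the linear term does. *)
Lemma prox_model_scale (d xi v : 'rV[R]_n) (mu L : R) :
  0 < mu -> mu <= L -> Q xi -> Q v ->
  exists2 u, Q u &
    prox_model N g d xi L u <= mu / L * prox_model N g d xi mu v.
Proof.
move=> mu0 muL Qxi Qv.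
have L0 : 0 < L by apply: lt_le_trans muL.
have t0 : 0 <= mu / L by rewrite divr_ge0// ltW.
have t1 : mu / L <= 1 by rewrite ler_pdivrMr// mul1r.
have tL : mu / L * L = mu by rewrite divfK// gt_eqF.
set t := mu / L in t0 t1 tL *.
(* Written this way, [u] is convertible to the convex combination that the convexity hypotheses on
   [Q] and [g] speak of. *)
pose u : 'rV[R]_n := t *: v + (1 - t) *: xi.
have uxi : u - xi = t *: (v - xi).
  by rewrite /u scalerBl scale1r scalerBr [xi - _]addrC addrA addrK.
exists u.
  apply/set_mem.
  exact: Q_convex v xi (Itv01 t0 t1) (mem_set Qv) (mem_set Qxi).
have gu : g u <= t * g v + (1 - t) * g xi.
  by apply: (g_convex (Itv01 t0 t1)); rewrite in_setT.
rewrite /prox_model uxi dotrZr (is_normZ N_norm) (ger0_norm t0).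
have -> : L / 2 * (t * N (v - xi)) ^+ 2 = t * (mu / 2 * N (v - xi) ^+ 2).
  by rewrite -tL; field.
by move: gu; lra.
Qed.

(** Stated for one block so that it serves both half steps: [phi] is to be [F] with the other block
    frozen, [d] the partial gradient at the current point and [s] the value [Fstar]. *)
Lemma block_step_contraction (phi : 'rV[R]_n -> R) (d xi z : 'rV[R]_n)
    (mu L s : R) :
  0 < mu -> mu <= L -> Q xi ->
  (forall u, Q u -> phi u <= phi xi + prox_model N g d xi L u) ->
  argmin Q phi z ->
  phi xi - (2 * mu)^-1 * prox_gap Q N g d xi mu <= s ->
  phi z - s <= (1 - mu / L) * (phi xi - s).
Proof.
move=> mu0 muL Qxi phi_le [_ z_min] PL.
have t0 : 0 < mu / L by rewrite divr_gt0// (lt_le_trans mu0).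
set t := mu / L in t0 *.
set m := inf [set prox_model N g d xi mu v | v in Q].
(* The factor [- 2 * mu] in [prox_gap] cancels against [(2 * mu)^-1]. *)
have {PL} mle : phi xi + m <= s.
  apply: le_trans PL; rewrite /prox_gap -/m le_eqVlt; apply/orP; left.
  by apply/eqP; field; rewrite gt_eqF.
(* Attainment of the infimum is avoided: the left side is a lower bound of all model values, and
   [v = xi] shows that the set of values is nonempty. *)
have mge : (phi z - phi xi) / t <= m.
  apply: lb_le_inf; first by exists (prox_model N g d xi mu xi), xi.
  move=> _ [v Qv <-]; rewrite ler_pdivrMr// mulrC.
  have [u Qu] := prox_model_scale d mu0 muL Qxi Qv.
  apply: le_trans; rewrite lerBlDl.
  exact: le_trans (z_min _ Qu) (phi_le _ Qu).
move: mge; rewrite ler_pdivrMr// => mge.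
(* Together, [phi z - phi xi <= m * t <= (s - phi xi) * t]. *)
have := ler_wpM2r (ltW t0) mle; lra.
Qed.

End BlockStep.

Theorem theorem4p1 (R : realType) (n1 n2 : nat)
    (Q1 : set 'rV[R]_n1) (Q2 : set 'rV[R]_n2)
    (N1 : 'rV[R]_n1 -> R) (N2 : 'rV[R]_n2 -> R)
    (f : 'rV[R]_n1 * 'rV[R]_n2 -> R)
    (g1 : 'rV[R]_n1 -> R) (g2 : 'rV[R]_n2 -> R)
    (L1 L2 mu1 mu2 Fstar : R)
    (x : nat -> 'rV[R]_n1 * 'rV[R]_n2)
    (Q1_neq0 : Q1 !=set0) (Q2_neq0 : Q2 !=set0)
    (Q1_closed : closed Q1) (Q2_closed : closed Q2)
    (Q1_convex : convex_set (Q1 : set (convex_lmodType 'rV[R]_n1)))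
    (Q2_convex : convex_set (Q2 : set (convex_lmodType 'rV[R]_n2)))
    (N1_norm : is_norm N1) (N2_norm : is_norm N2)
    (f_diff : forall p : 'rV[R]_n1 * 'rV[R]_n2, differentiable (f : _ -> R^o) p)
    (f_convex : @convex_function R ('rV[R]_n1 * 'rV[R]_n2)%type setT f)
    (L1_gt0 : 0 < L1) (L2_gt0 : 0 < L2)
    (f_smooth : forall u xi v eta, Q1 u -> Q1 xi -> Q2 v -> Q2 eta ->
      f (u, v) <= f (xi, eta) + dotr (grad1 f (xi, eta)) (u - xi)
                              + dotr (grad2 f (xi, eta)) (v - eta)
                              + L1 / 2 * N1 (u - xi) ^+ 2
                              + L2 / 2 * N2 (v - eta) ^+ 2)
    (g1_convex : @convex_function R 'rV[R]_n1 setT g1)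
    (g2_convex : @convex_function R 'rV[R]_n2 setT g2)
    (F := composite f g1 g2)
    (Fstar_min : exists2 p, argmin (Q1 `*` Q2) F p & F p = Fstar)
    (x_altmin : alternating_minimization Q1 Q2 f g1 g2 x)
    (mu1_gt0 : 0 < mu1) (mu1_le : mu1 <= L1)
    (mu2_gt0 : 0 < mu2) (mu2_le : mu2 <= L2)
    (PL1 : forall k,
      F (x k) - (2 * mu1)^-1 * D1 Q1 N1 f g1 (x k) mu1 <= Fstar)
    (PL2 : forall k,
      F (half_step x k)
        - (2 * mu2)^-1 * D2 Q2 N2 f g2 (half_step x k) mu2 <= Fstar) :
  forall k : nat,
    F (x k.+1) - Fstar <=
      (1 - mu2 / L2) * (1 - mu1 / L1) * (F (x k) - Fstar).
Proof.
move=> k.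
have [[Q1x0 Q2x0] step] := x_altmin.
have [Q1x Q2x] : Q1 (x k).1 /\ Q2 (x k).2.
  (* The starting point is feasible by assumption, later iterates because they are minimizers over
     [Q1] and [Q2]. *)
  by case: k => [//|k]; have [[Q1k _] [Q2k _]] := step k.
have [min1 min2] := step k.
have Q1x' : Q1 (x k.+1).1 by case: min1.
have first_step :
    F (half_step x k) - Fstar <= (1 - mu1 / L1) * (F (x k) - Fstar).
  rewrite [in leRHS](surjective_pairing (x k)).
  apply: (block_step_contraction Q1_convex N1_norm g1_convex
    (phi := fun u => F (u, (x k).2)) (d := grad1 f (x k))
    mu1_gt0 mu1_le Q1x _ _ _).
  - move=> u Q1u; rewrite /F /composite /prox_model /=.
    (* With both second components equal to [(x k).2], the terms of the second block vanish. *)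
    have := f_smooth _ _ _ _ Q1u Q1x Q2x Q2x.
    by rewrite subrr dotr0 (is_norm0 N2_norm) -surjective_pairing; lra.
  - by split=> // u Q1u; rewrite /F /composite /= lerD2r; exact: min1.2.
  - by rewrite -surjective_pairing; exact: PL1.
have second_step :
    F (x k.+1) - Fstar <= (1 - mu2 / L2) * (F (half_step x k) - Fstar).
  rewrite [x k.+1]surjective_pairing.
  apply: (block_step_contraction Q2_convex N2_norm g2_convex
    (phi := fun v => F ((x k.+1).1, v)) mu2_gt0 mu2_le Q2x _ _ (PL2 k)).
  - move=> v Q2v; rewrite /F /composite /prox_model /=.
    (* The base point is now the half step, whose first component is already [(x k.+1).1]. *)
    have := f_smooth _ _ _ _ Q1x' Q1x' Q2v Q2x.
    by rewrite subrr dotr0 (is_norm0 N1_norm) /half_step; lra.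
  - split; first by case: min2.
    move=> v Q2v; rewrite /F /composite /=.
    by have := min2.2 _ Q2v; lra.
(* Chaining the two contractions requires [1 - mu2 / L2] to be nonnegative, which is [mu2_le]. *)
apply: (le_trans second_step); rewrite -mulrA ler_wpM2l//.
by rewrite subr_ge0 ler_pdivrMr// mul1r.
Qed.
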